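(* In the log-bilinear model $$\eta_{jk}=\log\mu_{jk}=\alpha+\rho_j+\gamma_k+\tilde x_j^T\theta\,\tilde y_k=\alpha+\rho_j+\gamma_k+(\tilde y_k\otimes\tilde x_j)^T\vec\theta,\qquad 0\le j\le J,\ 0\le k\le K,$$ (under any of the four sampling schemes (M), (P), (MR), (MC)) the asymptotic covariance matrix of the estimator $\vec{\hat\theta}$ is $$\Sigma_{\hat\theta}=\Bigl(\bigl((\tilde Y^{\circ})^T\otimes(\tilde X^{\circ})^T\bigr)\,(C^TD^{-1}C)^{-1}\,\bigl(\tilde Y^{\circ}\otimes\tilde X^{\circ}\bigr)\Bigr)^{-1}$$ with $D=\mathrm{diag}\{\vec\mu\}$.
   Context: Tables. $J,K\ge 1$ are integers and $I=(J+1)(K+1)$. Tables $a=(a_{jk})$ with $0\le j\le J$, $0\le k\le K$ are identified with vectors $\vec a\in\mathbb R^I$ by stacking columns; more generally $\vec A$ denotes the vector obtained by stacking the columns of a matrix $A$, and tables indexed by $j=1,\dots,J$, $k=1,\dots,K$ are vectorized in the same way into $\mathbb R^{JK}$. $\vec e_{jk}\in\mathbb R^I$ is the unit vector of the table with a one at position $(j,k)$ and zeros elsewhere; a subscript $+$ denotes summation over the replaced index, e.g. $\vec e_{j+}=\sum_k\vec e_{jk}$, $\vec e_{+k}=\sum_j\vec e_{jk}$, $\vec e_{++}=\sum_{j,k}\vec e_{jk}$. $\otimes$ is the Kronecker product, $A\otimes B=(a_{ij}B)_{ij}$. Spaces. $\mathscr D=\mathrm{span}\{\vec e_{++}\}$,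 $\mathscr R=\mathrm{span}\{\vec e_{0+},\dots,\vec e_{J+}\}$, $\mathscr C=\mathrm{span}\{\vec e_{+0},\dots,\vec e_{+K}\}$. Projections. For a symmetric positive definite $I\times I$ matrix $D$ and a linear subspace $\mathscr M\subset\mathbb R^I$, $P^D_{\mathscr M}$ is the ($I\times I$ matrix of the) orthogonal projection onto $\mathscr M$ with respect to the inner product $\langle a,b\rangle_D=a^TDb$. Model. $R=(R_{jk})$ is a random table of counts with expected table $\mu=(\mu_{jk})=\mathbb E(R)$, all $\mu_{jk}>0$, $\eta_{jk}=\log\mu_{jk}$. Here $\rho_0=\gamma_0=0$, $\tilde x_0,\dots,\tilde x_J\in\mathbb R^{L_X}$ and $\tilde y_0,\dots,\tilde y_K\in\mathbb R^{L_Y}$ are known vectors with $\tilde x_0=0$, $\tilde y_0=0$, and $\theta$ is an unknown $L_X\times L_Y$ matrix; the parameters $\alpha$, $\rho_j$ $(j>0)$, $\gamma_k$ $(k>0)$, $\theta$ are otherwise unrestricted. $\mathscr H\subset\mathbb R^I$ is the linear space of all vectors $\vec\eta$ of the model form. $\tilde X^\circ$ is the $J\times L_X$ matrix with rows $\tilde x_j^T$, $j=1,\dots,J$, assumed to have rank $L_X$, and $\tilde Y^\circ$ is the $K\times L_Y$ matrix with rows $\tilde y_k^T$, $k=1,\dots,K$, assumed to have rank $L_Y$. $C$ is the $I\times JK$ matrix with columns $c_{jk}=\vec e_{jk}+\vec e_{00}-\vec e_{j0}-\vec e_{0k}$, $j,k>0$, ordered as the entries of a vectorized $J\times K$ table (consistent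 with the rows $(\tilde y_k\otimes\tilde x_j)^T$ of $\tilde Y^\circ\otimes\tilde X^\circ$). Sampling schemes. (M): $\vec R$ is multinomial with fixed total $n$; (P): the $R_{jk}$ are independent Poisson; (MR): the rows of $R$ are independent multinomial with fixed row totals; (MC): the columns of $R$ are independent multinomial with fixed column totals. The associated space is $\mathscr N=\mathscr D$ for (M), $\mathscr N=\{0\}$ for (P), $\mathscr N=\mathscr R$ for (MR), $\mathscr N=\mathscr C$ for (MC). Estimators and asymptotic covariance matrices. $\hat\mu$ is the maximum likelihood estimator of $\mu$ under $\vec\eta\in\mathscr H$, $\hat\eta=\log\hat\mu$, and $\vec{\hat\theta}$ is the parameter value in the model representation of $\hat\eta$ (the parameter $\vec\theta$ is a linear function of $\vec\eta\in\mathscr H$). By a theorem of Haberman (fixed cells, suitably increasing expectations), $\vec{\hat\eta}$ is asymptotically normal with asymptotic covariance matrix $\Sigma_{\hat\eta}=[P^D_{\mathscr H}-P^D_{\mathscr N}]D^{-1}$; this is taken as given. The asymptotic covariance matrix of an estimator that is a linear function $A\vec{\hat\eta}$ of $\vec{\hat\eta}$ is $A\Sigma_{\hat\eta}A^T$. *)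

(* Defs.v *)
From HB Require Import structures.
From mathcomp Require Import all_boot all_order all_algebra.
From mathcomp Require Import mxtens.
From mathcomp Require Import all_classical all_reals all_analysis.

Set Implicit Arguments.
Unset Strict Implicit.
Unset Printing Implicit Defensive.

Import Order.TTheory GRing.Theory Num.Theory.
Import numFieldNormedType.Exports.

Local Open Scope classical_set_scope.
Local Open Scope ring_scope.

(* Column stacking: [mxtens_index (k, j)] has value [k * m + j], so this is the
   vectorization for which [vec (u *m v^T) = v *t u].  The length is written
   [n * m] rather than [m * n] to agree definitionally with the type of [*t]. *)
Definition vec (T : Type) (m n : nat) (A : 'M[T]_(m, n)) : 'cV[T]_(n * m) :=
  \col_i A (mxtens_unindex i).2 (mxtens_unindex i).1.

Section Tables.
Variables (R : realType) (J K : nat).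

Notation table := 'M[R]_(J.+1, K.+1).
Notation vtable := 'cV[R]_(K.+1 * J.+1).

Definition unit_vec (j : 'I_J.+1) (k : 'I_K.+1) : vtable := vec (delta_mx j k).
Definition unit_row (j : 'I_J.+1) : vtable := \sum_k unit_vec j k.
Definition unit_col (k : 'I_K.+1) : vtable := \sum_j unit_vec j k.
Definition unit_all : vtable := \sum_j \sum_k unit_vec j k.

Definition span_set (s : seq vtable) : set vtable :=
  [set v | v \in span s].

Definition space_D : set vtable := span_set [:: unit_all].
Definition space_R : set vtable := span_set [seq unit_row j | j : 'I_J.+1].
Definition space_C : set vtable := span_set [seq unit_col k | k : 'I_K.+1].

Definition inner n (D : 'M[R]_n) (a b : 'cV[R]_n) : R := (a^T *m D *m b) 0 0.

(* The matrix is unique when [D] is symmetric positive definite, and it exists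
   when moreover [M] is a linear subspace; [xget] selects it. *)
Definition is_proj n (D : 'M[R]_n) (M : set 'cV[R]_n) (P : 'M[R]_n) : Prop :=
  forall v : 'cV[R]_n,
    M (P *m v) /\ forall u, M u -> inner D (v - P *m v) u = 0.

Definition proj n (D : 'M[R]_n) (M : set 'cV[R]_n) : 'M[R]_n :=
  xget 0 [set P | is_proj D M P].

Definition diag_table (mu : table) : 'M[R]_(K.+1 * J.+1) := diag_mx (vec mu)^T.

(* The column of index [mxtens_index (k, j)] is the contrast of the cell
   (j+1, k+1). *)
Definition contrast_mx : 'M[R]_(K.+1 * J.+1, K * J) :=
  \matrix_(i, q)
    let j := lift ord0 (mxtens_unindex q).2 in
    let k := lift ord0 (mxtens_unindex q).1 in
    (unit_vec j k + unit_vec ord0 ord0 - unit_vec j ord0 - unit_vec ord0 k) i 0.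

Definition positive_table (mu : table) : Prop := forall j k, 0 < mu j k.

Definition log_table (mu : table) : table := map_mx (@ln R) mu.

Inductive scheme := Multinomial | Poisson | RowMultinomial | ColMultinomial.

Definition fixed_space (s : scheme) : set vtable :=
  match s with
  | Multinomial => space_D
  | Poisson => [set 0]
  | RowMultinomial => space_R
  | ColMultinomial => space_C
  end.

(* [r] has the totals which the scheme fixes to those of the expected table. *)
Definition totals_agree (s : scheme) (mu : table)
    (r : 'M[nat]_(J.+1, K.+1)) : bool :=
  match s with
  | Multinomial =>
      \sum_j \sum_k mu j k == (\sum_j \sum_k r j k)%:R
  | Poisson => true
  | RowMultinomial => [forall j, \sum_k mu j k == (\sum_k r j k)%:R]
  | ColMultinomial => [forall k, \sum_j mu j k == (\sum_j r j k)%:R]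
  end.

Definition multinomial_pmf (I : finType) (mu : I -> R) (r : I -> nat) : R :=
  (\sum_i r i)`!%:R *
  \prod_i ((mu i / \sum_i' mu i') ^+ r i / (r i)`!%:R).

(* Probability of the table of counts [r] when the expected table is [mu]: the
   multinomial laws have cell probabilities [mu] divided by the fixed total. *)
Definition table_pmf (s : scheme) (mu : table)
    (r : 'M[nat]_(J.+1, K.+1)) : R :=
  if totals_agree s mu r then
    match s with
    | Multinomial =>
        multinomial_pmf (fun c : 'I_J.+1 * 'I_K.+1 => mu c.1 c.2)
                        (fun c => r c.1 c.2)
    | Poisson => \prod_j \prod_k poisson_pmf (mu j k) (r j k)
    | RowMultinomial => \prod_j multinomial_pmf (mu j) (r j)
    | ColMultinomial => \prod_k multinomial_pmf (mu^~ k) (r^~ k)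
    end
  else 0.

Definition sampled (s : scheme) d (T : measurableType d) (P : probability T R)
    (mu : table) (X : T -> 'M[nat]_(J.+1, K.+1)) : Prop :=
  forall r, measurable (X @^-1` [set r]) /\
            P (X @^-1` [set r]) = (table_pmf s mu r)%:E.

Section Model.
Variables (LX LY : nat).
Variables (xt : 'I_J.+1 -> 'cV[R]_LX) (yt : 'I_K.+1 -> 'cV[R]_LY).

Definition model_table (alpha : R) (rho : 'I_J.+1 -> R) (gamma : 'I_K.+1 -> R)
    (theta : 'M[R]_(LX, LY)) : table :=
  \matrix_(j, k)
    (alpha + rho j + gamma k + ((xt j)^T *m theta *m yt k) 0 0).

(* [eta] has the model form with interaction parameter [theta]. *)
Definition has_theta (eta : table) (theta : 'M[R]_(LX, LY)) : Prop :=
  exists alpha rho gamma, [/\ rho ord0 = 0, gamma ord0 = 0 &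
    eta = model_table alpha rho gamma theta].

Definition model_space : set vtable :=
  [set v | exists eta theta, has_theta eta theta /\ v = vec eta].

Definition X_mx : 'M[R]_(J, LX) := \matrix_(j, l) xt (lift ord0 j) l 0.
Definition Y_mx : 'M[R]_(K, LY) := \matrix_(k, l) yt (lift ord0 k) l 0.

Definition is_mle (s : scheme) (r : 'M[nat]_(J.+1, K.+1)) (m : table) : Prop :=
  let admissible m' := [/\ positive_table m',
    model_space (vec (log_table m')) & totals_agree s m' r] in
  admissible m /\
  forall m', admissible m' -> table_pmf s m' r <= table_pmf s m r.

(* Zero counts may prevent the maximum from being attained; the estimator is
   then an arbitrary positive table of the model. *)
Definition mle_estimator (s : scheme)
    (muhat : 'M[nat]_(J.+1, K.+1) -> table) : Prop :=
  forall r, [/\ positive_table (muhat r),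
    model_space (vec (log_table (muhat r))) &
    (exists m, is_mle s r m) -> is_mle s r (muhat r)].

(* [A] is the matrix of a linear map sending [vec eta] to [vec theta] for every
   [eta] of the model. *)
Definition theta_matrix (A : 'M[R]_(LY * LX, K.+1 * J.+1)) : Prop :=
  forall eta theta, has_theta eta theta -> A *m vec eta = vec theta.

Definition Sigma_eta (s : scheme) (mu : table) : 'M[R]_(K.+1 * J.+1) :=
  let D := diag_table mu in
  (proj D model_space - proj D (fixed_space s)) *m invmx D.

Definition contrast_cov (mu : table) : 'M[R]_(K * J) :=
  contrast_mx^T *m invmx (diag_table mu) *m contrast_mx.

Definition theta_info (mu : table) : 'M[R]_(LY * LX) :=
  (Y_mx^T *t X_mx^T) *m invmx (contrast_cov mu) *m (Y_mx *t X_mx).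

Definition Sigma_theta (mu : table) : 'M[R]_(LY * LX) := invmx (theta_info mu).

End Model.
End Tables.

(* [sqrt (a n) * (X n - x n)] converges in distribution to the (possibly
   degenerate) centered normal law with covariance matrix [S], expressed through
   the one-dimensional marginals (Cramer-Wold).  When [c^T S c = 0] the limit is
   the Dirac mass at 0, and its distribution function is tested away from its
   jump; [normal_prob] is not the Dirac mass for standard deviation 0. *)
Definition asymp_normal (R : realType) (d : nat -> measure_display)
    (T : forall n, measurableType (d n)) (P : forall n, probability (T n) R)
    (m : nat) (a : nat -> R) (X : forall n, T n -> 'cV[R]_m)
    (x : nat -> 'cV[R]_m) (S : 'M[R]_m) : Prop :=
  forall (c : 'cV[R]_m) (t : R),
    let v := (c^T *m S *m c) 0 0 in
    let F n := P n [set w | Num.sqrt (a n) * (c^T *m (X n w - x n)) 0 0 <= t] in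
    [/\ 0 <= v,
        v != 0 -> F @ \oo --> normal_prob 0 (Num.sqrt v) `]-oo, t] &
        v = 0 -> t != 0 -> F @ \oo --> (\d_(0 : R) `]-oo, t] : \bar R)].

(* Main.v *)
(* The vector eta belongs to the model with parameter theta iff its contrasts
   satisfy C^T eta = (Y *t X) theta.  So, with V = C^T D^-1 C, Z = Y *t X and
   W = Z^T V^-1 Z, the orthogonal projection onto the model space is
   1 - D^-1 C (V^-1 - V^-1 Z W^-1 Z^T V^-1) C^T, and the parameter map A
   satisfies A P_H = W^-1 Z^T V^-1 C^T (generalized least squares applied to the
   contrasts), hence A P_H D^-1 A^T = W^-1.  The spaces N fixed by the sampling
   schemes consist of additive tables, which have theta = 0, so A P_N = 0. *)

Require Import Defs.
From HB Require Import structures.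
From mathcomp Require Import all_boot all_order all_algebra.
From mathcomp Require Import mxtens ring.
From mathcomp Require Import all_classical all_reals all_analysis.

Set Implicit Arguments.
Unset Strict Implicit.
Unset Printing Implicit Defensive.

Import Order.TTheory GRing.Theory Num.Theory.
Import numFieldNormedType.Exports.

Local Open Scope classical_set_scope.
Local Open Scope ring_scope.

Lemma eq_cols (T : Type) m n (A B : 'M[T]_(m, n)) :
  (forall j, col j A = col j B) -> A = B.
Proof.
by move=> AB; apply/matrixP => i j; have /colP/(_ i) := AB j; rewrite !mxE.
Qed.

(** * Positive definite matrices and uniqueness of orthogonal projections *)

Section PositiveDefinite.
Variable R : realType.

Definition posdef n (S : 'M[R]_n) : Prop :=
  S^T = S /\ forall v, v != 0 -> 0 < inner S v v.

Lemma posdef_unitmx n (S : 'M[R]_n) : posdef S -> S \in unitmx.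
Proof.
case=> ST Sgt0; rewrite -row_free_unit -kermx_eq0.
apply/eqP/row_matrixP => i; rewrite row0; apply: contrapT => /eqP ki0.
have : 0 < inner S (row i (kermx S))^T (row i (kermx S))^T.
  by apply: Sgt0; rewrite trmx_eq0.
by rewrite /inner trmxK -row_mul mulmx_ker row0 mul0mx mxE ltxx.
Qed.

Lemma posdef_inv n (S : 'M[R]_n) : posdef S -> posdef (invmx S).
Proof.
move=> Spd; have Su := posdef_unitmx Spd; case: Spd => ST Sgt0.
split=> [|v v0]; first by rewrite trmx_inv ST.
rewrite /inner; have -> : v^T *m invmx S *m v =
  (invmx S *m v)^T *m S *m (invmx S *m v).
  by rewrite trmx_mul trmx_inv ST mulmxA mulmxKV.
apply: Sgt0; apply: contra_neq v0 => Sv0.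
by rewrite -[v](mulKVmx Su) Sv0 mulmx0.
Qed.

(** The left inverse [L] makes [B] injective, so [B *m v] is nonzero when [v] is. *)
Lemma posdef_congr n m (S : 'M[R]_n) (B : 'M[R]_(n, m)) (L : 'M[R]_(m, n)) :
  L *m B = 1%:M -> posdef S -> posdef (B^T *m S *m B).
Proof.
move=> LB [ST Sgt0]; split=> [|v v0].
  by rewrite !trmx_mul trmxK ST mulmxA.
rewrite /inner; have -> : v^T *m (B^T *m S *m B) *m v =
  (B *m v)^T *m S *m (B *m v) by rewrite trmx_mul !mulmxA.
apply: Sgt0; apply: contra_neq v0 => Bv0.
by rewrite -[v]mul1mx -LB -mulmxA Bv0 mulmx0.
Qed.

Lemma posdef_diag n (d : 'rV[R]_n) :
  (forall i, 0 < d 0 i) -> posdef (diag_mx d).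
Proof.
move=> d0; split=> [|v v0]; first exact: tr_diag_mx.
have dv i : 0 <= v i 0 * d 0 i * v i 0.
  by rewrite mulrAC -expr2 mulr_ge0 ?sqr_ge0 // ltW.
have -> : inner (diag_mx d) v v = \sum_i v i 0 * d 0 i * v i 0.
  by rewrite /inner mul_mx_diag mxE; apply: eq_bigr => i _; rewrite !mxE.
rewrite lt_neqAle sumr_ge0 // andbT eq_sym; apply: contra_neq v0.
move=> /eqP; rewrite psumr_eq0 // => /allP z.
apply/colP => i; rewrite mxE; have := z i (mem_index_enum i).
by rewrite /= !mulf_eq0 (gt_eqF (d0 i)) orbF orbb => /eqP.
Qed.

Lemma innerBl n (D : 'M[R]_n) u v w :
  inner D (u - v) w = inner D u w - inner D v w.
Proof. by rewrite /inner linearB /= !mulmxBl !mxE. Qed.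

(** The difference of two projections of [v] lies in [M] and is orthogonal to [M], hence to itself;
    definiteness forces it to vanish. *)
Lemma is_proj_uniq n (D : 'M[R]_n) (M : set 'cV[R]_n) (P Q : 'M[R]_n) :
  posdef D -> (forall u v, M u -> M v -> M (u - v)) ->
  is_proj D M P -> is_proj D M Q -> P = Q.
Proof.
move=> [_ Dgt0] MB pP pQ; apply/eq_cols => i; rewrite !colE.
set v := delta_mx i 0; have [MP oP] := pP v; have [MQ oQ] := pQ v.
set w := P *m v - Q *m v; have Mw : M w by exact: MB.
apply/eqP; rewrite -subr_eq0; apply: contraT => /Dgt0.
rewrite -/w; suff -> : inner D w w = 0 by rewrite ltxx.
have -> : inner D w w = inner D (v - Q *m v) w - inner D (v - P *m v) w.
  by rewrite -innerBl opprB addrC addrA subrK.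
by rewrite oP // oQ // subrr.
Qed.

End PositiveDefinite.

(** * Projection onto a space cut out by linear constraints, and generalized least squares *)

Section ConstrainedProjection.
Variables (R : realType) (n m p : nat).
Variables (D : 'M[R]_n) (C : 'M[R]_(n, m)) (Z : 'M[R]_(m, p)).
Variables (C' : 'M[R]_(m, n)) (Z' : 'M[R]_(p, m)).
(** The left inverses [C'] and [Z'] express that [C] and [Z] have full column rank. *)
Hypotheses (D_pd : posdef D) (CK : C' *m C = 1%:M) (ZK : Z' *m Z = 1%:M).

Let V := C^T *m invmx D *m C.
Let W := Z^T *m invmx V *m Z.
Let H : set 'cV[R]_n := [set v | exists t, C^T *m v = Z *m t].

Lemma constraint_cov_posdef : posdef V.
Proof. exact: posdef_congr CK (posdef_inv D_pd). Qed.

Lemma constraint_info_posdef : posdef W.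
Proof. exact: posdef_congr ZK (posdef_inv constraint_cov_posdef). Qed.

(** [G *m v] is the generalized least squares fit of [t] in [C^T *m v = Z *m t] with covariance [V].
    [P *m v] is the point nearest to [v] in the [D]-norm whose contrasts are the fitted ones;
    [invmx V] applied to the residual contrasts gives the Lagrange multipliers. *)
Let G := invmx W *m Z^T *m invmx V *m C^T.
Let P := 1%:M - invmx D *m C *m invmx V *m (C^T - Z *m G).

Let Vu : V \in unitmx. Proof. exact/posdef_unitmx/constraint_cov_posdef. Qed.
Let Wu : W \in unitmx. Proof. exact/posdef_unitmx/constraint_info_posdef. Qed.
Let Du : D \in unitmx. Proof. exact: posdef_unitmx. Qed.

Lemma constraint_projE : C^T *m P = Z *m G.
Proof.
rewrite mulmxBr mulmx1 !mulmxA -/V mulmxV // mul1mx.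
by rewrite opprB addrC subrK.
Qed.

(** Orthogonality to [H] comes down to the normal equations: the residual operator [C^T - Z *m G] is
    orthogonal to the range of [Z] with respect to [invmx V]. *)
Lemma is_proj_constraint : is_proj D H P.
Proof.
move=> v; split=> [|u [t Cu]].
  by exists (G *m v); rewrite mulmxA constraint_projE -mulmxA.
have -> : v - P *m v = invmx D *m C *m invmx V *m (C^T - Z *m G) *m v.
  by rewrite mulmxBl mul1mx opprB addrC subrK.
have [VT _] := constraint_cov_posdef.
have [WT _] := constraint_info_posdef.
have [DT _] := D_pd.
rewrite /inner !trmx_mul linearB /= !trmx_mul !trmx_inv VT WT DT !trmxK.
have WE x : Z^T *m (invmx V *m (Z *m x)) = W *m x by rewrite !mulmxA.
rewrite -!mulmxA (mulKmx Du) Cu mulmxBl -!mulmxA WE (mulKmx Wu) subrr.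
by rewrite mulmx0 mxE.
Qed.

(** Since [P] is a projection, [xget] returns a genuine one, and uniqueness identifies it with
    [P]. *)
Lemma proj_constraint : Defs.proj D H = P.
Proof.
have MB u v : H u -> H v -> H (u - v).
  by move=> [s Hs] [t Ht]; exists (s - t); rewrite !mulmxBr Hs Ht.
apply: is_proj_uniq D_pd MB _ is_proj_constraint.
by apply: xgetPex; exists P; exact: is_proj_constraint.
Qed.

Lemma param_proj_cov (A : 'M[R]_(p, n)) :
  (forall (v : 'cV_n) t, C^T *m v = Z *m t -> A *m v = t) ->
  A *m Defs.proj D H *m invmx D *m A^T = invmx W.
Proof.
move=> A_param; rewrite proj_constraint.
(* The defining property of [A] on vectors, extended to matrices column by column. *)
have mulA q (M : 'M[R]_(n, q)) (N : 'M[R]_(p, q)) :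
  C^T *m M = Z *m N -> A *m M = N.
  move=> MN; apply/eq_cols => i; rewrite !colE -mulmxA; apply: A_param.
  by rewrite !mulmxA MN.
have [VT _] := constraint_cov_posdef.
have [WT _] := constraint_info_posdef.
have [DT _] := D_pd.
(* First use of [mulA]: the product of [A] with the projection is [G]. After transposition [A]
   stands on the left again, and a second use applies to [invmx D *m C *m invmx V *m Z *m invmx W],
   whose contrasts are [Z *m invmx W]. *)
rewrite (mulA _ _ _ constraint_projE); apply: trmx_inj.
rewrite !trmx_mul !trmx_inv VT WT DT !trmxK.
apply: mulA; rewrite !mulmxA -/V.
by rewrite mulmxV // mul1mx.
Qed.

End ConstrainedProjection.

(** * Vectorization and Kronecker products *)

Section Vectorization.
Variable R : realType.

Lemma vecE m n (A : 'M[R]_(m, n)) j k :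
  vec A (mxtens_index (k, j)) 0 = A j k.
Proof. by rewrite mxE mxtens_indexK. Qed.

Lemma vec_surj m n (v : 'cV[R]_(n * m)) : exists A : 'M[R]_(m, n), v = vec A.
Proof.
exists (\matrix_(j, k) v (mxtens_index (k, j)) 0).
by apply/colP => i; case: (mxtens_indexP i) => k j; rewrite vecE mxE.
Qed.

Lemma vec_inj m n : injective (@vec R m n).
Proof. by move=> A B AB; apply/matrixP => j k; rewrite -[LHS]vecE AB vecE. Qed.

Lemma vec0 m n : vec (0 : 'M[R]_(m, n)) = 0.
Proof. by apply/colP => i; rewrite !mxE. Qed.

Lemma tensmx_vec m n p q (B : 'M[R]_(m, n)) (A : 'M[R]_(p, q)) M :
  (B *t A) *m vec M = vec (A *m M *m B^T).
Proof.
apply/colP => i; case: (mxtens_indexP i) => k j.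
rewrite vecE mxE [RHS]mxE.
(* The flat summation index is replaced by a pair, which turns the sum into a double sum. *)
rewrite (reindex (@mxtens_index n q)) /=; last first.
  exists (@mxtens_unindex n q) => x _; first exact: mxtens_indexK.
  exact: mxtens_unindexK.
transitivity (\sum_x \sum_y B k x * A j y * M y x).
  by rewrite pair_bigA; apply: eq_bigr => -[x y] _; rewrite tensmxE vecE.
apply: eq_bigr => x _; rewrite !mxE mulr_suml; apply: eq_bigr => y _.
by rewrite -mulrA mulrC.
Qed.

(** Full column rank gives each factor a left inverse, and the Kronecker product of these inverts
    [B *t A] on the left. *)
Lemma tensmx_linv m n p q (B : 'M[R]_(m, n)) (A : 'M[R]_(p, q)) :
  \rank B = n -> \rank A = q -> exists L, L *m (B *t A) = 1%:M.
Proof.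
move=> /eqP/row_fullP[B' BK] /eqP/row_fullP[A' AK].
exists (B' *t A'); rewrite tensmx_mul BK AK; apply/matrixP => i j.
case: (mxtens_indexP i) (mxtens_indexP j) => k l [k' l'].
rewrite tensmxE !mxE (can_eq (@mxtens_indexK _ _)) xpair_eqE.
by case: eqP; case: eqP; rewrite ?mulr0 ?mul0r ?mulr1.
Qed.

End Vectorization.

(** * The contrast matrix and its rank *)

Section Contrasts.
Variables (R : realType) (J K : nat).
Implicit Type eta : 'M[R]_(J.+1, K.+1).

Lemma unit_vecE j k : unit_vec R j k = delta_mx (mxtens_index (k, j)) 0
  :> 'cV[R]_(K.+1 * J.+1).
Proof.
apply/colP => i; case: (mxtens_indexP i) => k' j'; rewrite vecE !mxE.
by rewrite (can_eq (@mxtens_indexK _ _)) xpair_eqE andbT andbC.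
Qed.

Lemma trmx_unit_vec_mul j k eta :
  ((unit_vec R j k)^T *m vec eta) 0 0 = eta j k.
Proof. by rewrite unit_vecE trmx_delta -rowE mxE vecE. Qed.

Lemma col_contrast_mx j k :
  col (mxtens_index (k, j)) (contrast_mx R J K) =
  unit_vec R (lift ord0 j) (lift ord0 k) + unit_vec R ord0 ord0
  - unit_vec R (lift ord0 j) ord0 - unit_vec R ord0 (lift ord0 k).
Proof. by apply/colP => i; rewrite 2!mxE mxtens_indexK. Qed.

Lemma trmx_contrast_mul eta :
  (contrast_mx R J K)^T *m vec eta =
  vec (\matrix_(j, k) (eta (lift ord0 j) (lift ord0 k) + eta ord0 ord0
                       - eta (lift ord0 j) ord0 - eta ord0 (lift ord0 k))).
Proof.
apply/colP => q; case: (mxtens_indexP q) => k j; rewrite vecE [RHS]mxE.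
transitivity (((col (mxtens_index (k, j)) (contrast_mx R J K))^T
               *m vec eta) 0 0).
  by rewrite tr_col -row_mul [RHS]mxE.
rewrite col_contrast_mx -!trmx_unit_vec_mul !linearB linearD /= !mulmxBl mulmxDl.
by rewrite 3!mxE; congr (_ + _ + _); rewrite mxE.
Qed.

Lemma contrast_linv : exists L, L *m contrast_mx R J K = 1%:M.
Proof.
(* This witness selects the cells with both indices positive. A contrast has a one at its own such
   cell, and its three other terms lie in row or column 0. *)
exists (\matrix_q delta_mx 0 (mxtens_index (lift ord0 (mxtens_unindex q).1,
                                        lift ord0 (mxtens_unindex q).2))).
apply/row_matrixP => q; rewrite row_mul rowK -rowE; apply/rowP => q'.
case: (mxtens_indexP q) (mxtens_indexP q') => k j [k' j'].
rewrite mxtens_indexK mxE.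
transitivity (col (mxtens_index (k', j')) (contrast_mx R J K)
  (mxtens_index (lift ord0 k, lift ord0 j)) 0); first by rewrite [RHS]mxE.
rewrite col_contrast_mx !unit_vecE.
rewrite !mxE !(can_eq (@mxtens_indexK _ _)) !xpair_eqE.
rewrite !(inj_eq lift_inj) !(eq_sym (lift _ _) ord0) !(negPf (neq_lift _ _)) /=.
by rewrite andbF addr0 !subr0 andbC.
Qed.

Lemma diag_table_posdef eta : positive_table eta -> posdef (diag_table eta).
Proof. by move=> eta0; apply: posdef_diag => i; rewrite !mxE; exact: eta0. Qed.

End Contrasts.

(** * The model space and the parameter map in terms of contrasts *)

Section ModelTheta.
Variables (R : realType) (J K LX LY : nat).
Variables (xt : 'I_J.+1 -> 'cV[R]_LX) (yt : 'I_K.+1 -> 'cV[R]_LY).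
Implicit Type eta : 'M[R]_(J.+1, K.+1).

Lemma model_tableE alpha rho gamma theta j k :
  model_table xt yt alpha rho gamma theta j k =
  alpha + rho j + gamma k + ((yt k *t xt j)^T *m vec theta) 0 0.
Proof.
by rewrite mxE trmx_tens tensmx_vec trmxK [in RHS]mxE !ord1.
Qed.

Hypotheses (xt0 : xt ord0 = 0) (yt0 : yt ord0 = 0).

Let C := contrast_mx R J K.
Let Z := Y_mx yt *t X_mx xt.

Lemma design_mulE theta : Z *m vec theta =
  vec (\matrix_(j, k)
    ((xt (lift ord0 j))^T *m theta *m yt (lift ord0 k)) 0 0).
Proof.
rewrite tensmx_vec; congr vec; apply/matrixP => j k.
rewrite [in RHS]mxE [LHS]mxE [RHS]mxE; apply: eq_bigr => l _.
congr (_ * _); last by rewrite !mxE.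
rewrite [LHS]mxE [RHS]mxE; apply: eq_bigr => l' _.
by rewrite !mxE.
Qed.

(** Contrasts cancel the main effects and keep the interaction, which vanishes in row and column 0
    because [xt ord0] and [yt ord0] are zero. Conversely, row and column 0 of [eta] determine the
    main effects, and the contrasts the remaining cells. *)
Lemma has_thetaP eta theta :
  has_theta xt yt eta theta <-> C^T *m vec eta = Z *m vec theta.
Proof.
have z : (0 : 'M[R]_1) 0 0 = 0 by rewrite mxE.
have modelE alpha rho gamma j k : model_table xt yt alpha rho gamma theta j k =
  alpha + rho j + gamma k + ((xt j)^T *m theta *m yt k) 0 0 by rewrite mxE.
rewrite trmx_contrast_mul design_mulE; split=> [|/vec_inj/matrixP CE].
  move=> [alpha [rho [gamma [rho0 gamma0 ->]]]]; congr vec.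
  apply/matrixP => j k; rewrite mxE [RHS]mxE !modelE.
  rewrite xt0 yt0 trmx0 !mul0mx !mulmx0 rho0 gamma0 z; ring.
exists (eta ord0 ord0), (fun j => eta j ord0 - eta ord0 ord0),
  (fun k => eta ord0 k - eta ord0 ord0).
rewrite !subrr; split=> //; apply/matrixP => j k; rewrite modelE.
(* In row or column 0 the interaction is zero and the chosen main effects reproduce [eta]; elsewhere
   the contrast equation [CE] is used. *)
case: (unliftP ord0 j) => [j'|] ->; last by rewrite xt0 trmx0 !mul0mx z; ring.
case: (unliftP ord0 k) => [k'|] ->; last by rewrite yt0 mulmx0 z; ring.
by have := CE j' k'; rewrite mxE [RHS]mxE => <-; ring.
Qed.

Lemma model_spaceE :
  model_space xt yt = [set v | exists t, C^T *m v = Z *m t].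
Proof.
apply/seteqP; split=> v /= [].
  by move=> eta [theta [/has_thetaP etaE ->]]; exists (vec theta).
have [eta ->] := vec_surj v; move=> t; have [theta ->] := vec_surj t.
by move=> /has_thetaP etaP; exists eta, theta.
Qed.

Lemma theta_matrixP A : theta_matrix xt yt A <->
  (forall (v : 'cV_(K.+1 * J.+1)) t, C^T *m v = Z *m t -> A *m v = t).
Proof.
split=> [At v t|At eta theta /has_thetaP]; last exact: At.
have [eta ->] := vec_surj v; have [theta ->] := vec_surj t.
by move=> /has_thetaP/At.
Qed.

Section ThetaMatrix.
Variable A : 'M[R]_(LY * LX, K.+1 * J.+1).
Hypothesis A_theta : theta_matrix xt yt A.

(** All contrasts of an additive table vanish, so it satisfies the contrast equation with parameter
    0. *)
Lemma theta_matrix_additive f g : A *m vec (\matrix_(j, k) (f j + g k)) = 0.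
Proof.
have /theta_matrixP := A_theta; apply.
rewrite trmx_contrast_mul mulmx0 -(vec0 R J K); congr vec.
by apply/matrixP => j k; rewrite !mxE; ring.
Qed.

Lemma theta_matrix_unit_row j : A *m unit_row R K j = 0.
Proof.
rewrite -(theta_matrix_additive (fun i => (i == j)%:R) (fun _ => 0)).
congr (_ *m _); apply/colP => i; case: (mxtens_indexP i) => k' j'.
rewrite vecE mxE addr0 summxE (bigD1 k') //= big1 => [|k kk'].
  by rewrite vecE mxE eqxx andbT addr0.
by rewrite vecE mxE (eq_sym k') (negPf kk') andbF.
Qed.

Lemma theta_matrix_unit_col k : A *m unit_col R J k = 0.
Proof.
rewrite -(theta_matrix_additive (fun _ => 0) (fun i => (i == k)%:R)).
congr (_ *m _); apply/colP => i; case: (mxtens_indexP i) => k' j'.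
rewrite vecE mxE add0r summxE (bigD1 j') //= big1 => [|j jj'].
  by rewrite vecE mxE eqxx addr0.
by rewrite vecE mxE eq_sym (negPf jj').
Qed.

Lemma theta_matrix_span (e : seq 'cV[R]_(K.+1 * J.+1)) v :
  (forall u, u \in e -> A *m u = 0) -> span_set e v -> A *m v = 0.
Proof.
move=> Ae /(@coord_span _ _ _ (in_tuple e)) ->.
rewrite mulmx_sumr big1 // => i _.
by rewrite -scalemxAr Ae ?scaler0 // mem_nth.
Qed.

Lemma theta_matrix_fixed s v : fixed_space s v -> A *m v = 0.
Proof.
case: s => /=; last 3 first.
- by move=> ->; rewrite mulmx0.
- by apply: theta_matrix_span => u /mapP[j _ ->]; exact: theta_matrix_unit_row.
- by apply: theta_matrix_span => u /mapP[j _ ->]; exact: theta_matrix_unit_col.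
(* The multinomial case, moved to the end: [unit_all] is the sum of the vectors [unit_row j]. *)
apply: theta_matrix_span => u; rewrite inE => /eqP ->.
by rewrite mulmx_sumr big1 // => j _; exact: theta_matrix_unit_row.
Qed.

Lemma theta_matrix_proj_fixed s D : A *m Defs.proj D (fixed_space s) = 0.
Proof.
(* Either a projection exists, and its columns lie in the fixed space, or [xget] falls back to the
   zero matrix; [A] annihilates both. *)
rewrite /Defs.proj; case: xgetP => [P _ pP|_]; last by rewrite mulmx0.
apply: eq_cols => i; rewrite colE col0 -mulmxA.
exact: theta_matrix_fixed (pP _).1.
Qed.

End ThetaMatrix.

Hypotheses (rankX : \rank (X_mx xt) = LX) (rankY : \rank (Y_mx yt) = LY).

Lemma theta_matrix_exists : exists A, theta_matrix xt yt A.
Proof.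
have [L LZ] := tensmx_linv rankY rankX.
(* Taking contrasts and then a left inverse of [Z] recovers the parameter. *)
exists (L *m C^T); apply/theta_matrixP => v t Cv.
by rewrite -mulmxA Cv mulmxA LZ mul1mx.
Qed.

(** * Invertibility and the covariance formula *)

Section Covariance.
Variable mu : 'M[R]_(J.+1, K.+1).
Hypothesis mu_gt0 : positive_table mu.

Lemma contrast_cov_unitmx : contrast_cov mu \in unitmx.
Proof.
have [L LC] := contrast_linv R J K.
exact: posdef_unitmx (constraint_cov_posdef (diag_table_posdef mu_gt0) LC).
Qed.

Lemma theta_infoE :
  theta_info xt yt mu = Z^T *m invmx (contrast_cov mu) *m Z.
Proof. by rewrite /theta_info trmx_tens. Qed.

Lemma theta_info_unitmx : theta_info xt yt mu \in unitmx.
Proof.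
have [L LC] := contrast_linv R J K; have [M MZ] := tensmx_linv rankY rankX.
rewrite theta_infoE; apply: posdef_unitmx.
exact: constraint_info_posdef (diag_table_posdef mu_gt0) LC MZ.
Qed.

Lemma theta_matrix_cov s A : theta_matrix xt yt A ->
  A *m Sigma_eta xt yt s mu *m A^T = Sigma_theta xt yt mu.
Proof.
move=> At; have [L LC] := contrast_linv R J K.
have [M MZ] := tensmx_linv rankY rankX.
rewrite /Sigma_eta mulmxA mulmxBr theta_matrix_proj_fixed // subr0.
rewrite model_spaceE /Sigma_theta theta_infoE.
apply: param_proj_cov (diag_table_posdef mu_gt0) LC MZ _ _.
exact/theta_matrixP.
Qed.

End Covariance.

End ModelTheta.

(** In the Cramer-Wold formulation, testing the image under [A] in direction [c] is testing the
    original vector in direction [A^T *m c], with the same variance. *)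
Lemma asymp_normal_mulmx (R : realType) (d : nat -> measure_display)
    (T : forall n, measurableType (d n)) (P : forall n, probability (T n) R)
    (m p : nat) (a : nat -> R) (X : forall n, T n -> 'cV[R]_m)
    (x : nat -> 'cV[R]_m) (S : 'M[R]_m) (A : 'M[R]_(p, m)) :
  asymp_normal P a X x S ->
  asymp_normal P a (fun n w => A *m X n w) (fun n => A *m x n)
    (A *m S *m A^T).
Proof.
move=> XS c t; move: (XS (A^T *m c) t) => /=.
have -> : (A^T *m c)^T *m S *m (A^T *m c) = c^T *m (A *m S *m A^T) *m c.
  by rewrite trmx_mul trmxK !mulmxA.
suff -> : (fun n => P n [set w | Num.sqrt (a n) *
      ((A^T *m c)^T *m (X n w - x n)) 0 0 <= t]) =
    (fun n => P n [set w | Num.sqrt (a n) *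
      (c^T *m (A *m X n w - A *m x n)) 0 0 <= t]) by [].
apply/funext => n; congr (P n _); apply: eq_set => w.
by rewrite trmx_mul trmxK -mulmxA mulmxBr.
Qed.

Theorem corollary1 (R : realType) (J K LX LY : nat)
    (J_gt0 : (0 < J)%N) (K_gt0 : (0 < K)%N)
    (xt : 'I_J.+1 -> 'cV[R]_LX) (yt : 'I_K.+1 -> 'cV[R]_LY)
    (xt0 : xt ord0 = 0) (yt0 : yt ord0 = 0)
    (rankX : \rank (X_mx xt) = LX) (rankY : \rank (Y_mx yt) = LY)
    (s : scheme) :
  [/\ forall alpha rho gamma theta j k,
     model_table xt yt alpha rho gamma theta j k =
     alpha + rho j + gamma k + ((yt k *t xt j)^T *m vec theta) 0 0,
   forall mu : 'M[R]_(J.+1, K.+1),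
     positive_table mu -> model_space xt yt (vec (log_table mu)) ->
     [/\ contrast_cov mu \in unitmx,
         theta_info xt yt mu \in unitmx,
         exists A, theta_matrix xt yt A &
         forall A, theta_matrix xt yt A ->
           A *m Sigma_eta xt yt s mu *m A^T = Sigma_theta xt yt mu] &
   forall (d : nat -> measure_display)
     (T : forall n, measurableType (d n))
     (P : forall n, probability (T n) R)
     (mu : nat -> 'M[R]_(J.+1, K.+1)) (theta : nat -> 'M[R]_(LX, LY))
     (X : forall n, T n -> 'M[nat]_(J.+1, K.+1))
     (muhat : 'M[nat]_(J.+1, K.+1) -> 'M[R]_(J.+1, K.+1))
     (thetahat : 'M[nat]_(J.+1, K.+1) -> 'M[R]_(LX, LY))
     (a : nat -> R) (mustar : 'M[R]_(J.+1, K.+1)),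
     (forall n, positive_table (mu n)) ->
     (forall n, has_theta xt yt (log_table (mu n)) (theta n)) ->
     (forall n, sampled s (P n) (mu n) (X n)) ->
     mle_estimator xt yt s muhat ->
     (forall r, has_theta xt yt (log_table (muhat r)) (thetahat r)) ->
     (forall n, 0 < a n) -> a @ \oo --> +oo ->
     positive_table mustar ->
     (forall j k, (fun n => mu n j k / a n) @ \oo --> mustar j k) ->
     asymp_normal P a (fun n w => vec (log_table (muhat (X n w))))
       (fun n => vec (log_table (mu n))) (Sigma_eta xt yt s mustar) ->
     asymp_normal P a (fun n w => vec (thetahat (X n w)))
       (fun n => vec (theta n)) (Sigma_theta xt yt mustar)].
Proof.
split=> [alpha rho gamma theta j k||]; first exact: model_tableE.
  move=> mu mu_gt0 _; split; [exact: contrast_cov_unitmx|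
    exact: theta_info_unitmx|exact: theta_matrix_exists|].
  by move=> A; exact: theta_matrix_cov.
move=> d T P mu theta X muhat thetahat a mustar _ mu_theta _ _ muhat_theta _ _.
move=> mustar_gt0 _ eta_normal.
(* The true and the estimated log-tables both belong to the model, so one matrix [A] sends them to
   [theta] and [thetahat]; the limit law is transported along [A]. *)
have [A At] := theta_matrix_exists xt0 yt0 rankX rankY.
rewrite -(theta_matrix_cov xt0 yt0 rankX rankY mustar_gt0 s At).
have := asymp_normal_mulmx A eta_normal.
have -> : (fun n => A *m vec (log_table (mu n))) = (fun n => vec (theta n)).
  by apply/funext => n; exact: At.
have -> // : (fun n w => A *m vec (log_table (muhat (X n w)))) =
  (fun n w => vec (thetahat (X n w))).
(* The sample space [T n] varies with [n], hence dependent extensionality in the outer argument. *)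
by apply/functional_extensionality_dep => n; apply/funext => w; exact: At.
Qed.
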